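(* For all $i \in \mathbb{N}$ and real $y\ge 2$, $$ \mathcal{S}_y\subseteq \mathcal{B}_{\theta_l} \subseteq \mathcal{D}^*_{i,y} \subseteq \mathcal{D}_{i,y} \subseteq \mathcal{B}_{\theta_u}, $$ where $$ \theta_l(n) = \max(y, (yn)^{1/i}), \quad \theta_u(n) = y n^{1/i}. $$
   Context: $\mathbb{N}=\{1,2,\ldots\}$. $\mathcal{S}_y$ is the set of natural numbers all of whose prime factors are $\le y$. For a real arithmetic function $\theta$, $\mathcal{B}_\theta$ is the set of positive integers containing $n=1$ and all $n=p_1\cdots p_k$ whose prime factors $p_1\le \cdots \le p_k$ satisfy $p_{j+1} \le \theta ( p_1\cdots p_{j})$ for $0\le j < k$ (the empty product being $1$). A finite increasing sequence of natural numbers is called $y$-dense if the ratios of consecutive terms are all $\le y$. Define $\mathcal{D}_{0,y}=\mathbb{N}$. For $i\ge 1$, $n\in \mathcal{D}_{i,y}$ if and only if the increasing sequence $\{d: d|n,\ d\in \mathcal{D}_{i-1,y}\}$ is a $y$-dense sequence containing $1$ and $n$. Define $\mathcal{D}^*_{0,y}=\mathbb{N}$. For $i\ge 1$, $n\in \mathcal{D}^*_{i,y}$ if and only if for each $j$ with $0\le j \le i-1$, the increasing sequence $\{d: d|n,\ d\in \mathcal{D}^*_{j,y} \text{ and } n/d \in \mathcal{D}^*_{i-1-j,y} \}$ is a $y$-dense sequence containing $1$ and $n$. *)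

(* Defs.v *)
From mathcomp Require Import all_boot all_order all_algebra.
From mathcomp Require Import all_classical all_reals all_analysis.

Set Implicit Arguments.
Unset Strict Implicit.
Unset Printing Implicit Defensive.

Import Order.TTheory GRing.Theory Num.Theory.

Local Open Scope classical_set_scope.
Local Open Scope ring_scope.

Definition smooth (R : realType) (y : R) : set nat :=
  [set n | (0 < n)%N /\ forall p : nat, prime p -> (p %| n)%N -> p%:R <= y].

(* The sequence [p] is the nondecreasing factorization of [n] into primes, with
   multiplicity, indexed from 0: [nth 0 p j] is the factor p_{j+1}, and
   [take j p] consists of p_1, ..., p_j. The case [p = [::]] gives n = 1. *)
Definition B_ (R : realType) (theta : nat -> R) : set nat :=
  [set n | exists p : seq nat,
    [/\ sorted leq p, all prime p, n = (\prod_(q <- p) q)%N &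
        forall j : nat, (j < size p)%N ->
          (nth 0%N p j)%:R <= theta (\prod_(q <- take j p) q)%N]].

Definition y_dense (R : realType) (y : R) (s : seq nat) : bool :=
  sorted ltn s && sorted [rel a b : nat | b%:R / a%:R <= y] s.

(* [divisors n] is increasing when 0 < n, and empty when n = 0, so that 0
   belongs to none of the sets below. *)
Fixpoint D_ (R : realType) (y : R) (i : nat) : set nat :=
  match i with
  | 0 => [set n | (0 < n)%N]
  | i'.+1 => [set n |
      let s := [seq d <- divisors n | d \in D_ y i'] in
      [/\ y_dense y s, 1%N \in s & n \in s]]
  end.

(* For j <= i', the index [i' - (i' - j)] is j, written so that the recursive
   call is structural; see [Dstar_S]. *)
Fixpoint Dstar (R : realType) (y : R) (i : nat) : set nat :=
  match i with
  | 0 => [set n | (0 < n)%N]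
  | i'.+1 => [set n | forall j : nat, (j <= i')%N ->
      let s := [seq d <- divisors n | (d \in Dstar y (i' - (i' - j)))
                                      && ((n %/ d)%N \in Dstar y (i' - j))] in
      [/\ y_dense y s, 1%N \in s & n \in s]]
  end.

Lemma Dstar_S (R : realType) (y : R) (i n : nat) :
  Dstar y i.+1 n <->
  forall j : nat, (j <= i)%N ->
    let s := [seq d <- divisors n | (d \in Dstar y j)
                                    && ((n %/ d)%N \in Dstar y (i - j))] in
    [/\ y_dense y s, 1%N \in s & n \in s].
Proof. by split=> H j ji; have := H j ji; rewrite subKn. Qed.

Definition theta_l (R : realType) (y : R) (i n : nat) : R :=
  Num.max y ((y * n%:R) `^ i%:R^-1).

Definition theta_u (R : realType) (y : R) (i n : nat) : R :=
  y * n%:R `^ i%:R^-1.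

(* Main.v *)
(* Density of a set of divisors of [n] containing 1 and [n] means that every
   integer [t < n] is followed by a member in the interval (t, yt]. Taking
   [j = i - 1] gives Dstar_i in D_i. For D_i in B, the gap above the part of [n]
   made of the primes below [p] bounds [p]. For B in Dstar_i, any [n] in the
   set attached to [i = a + b + 1] splits as [n = d * e] with [d] in (t, yt] and
   [d], [e] in the sets attached to [a] and [b]. *)
Require Import Defs.
From mathcomp Require Import all_boot all_order all_algebra.
From mathcomp Require Import all_classical all_reals all_analysis.
From mathcomp Require Import zify lra.

Import Order.TTheory GRing.Theory Num.Theory.

Local Open Scope classical_set_scope.
Local Open Scope ring_scope.

(** * Nondecreasing prime factorizations *)

Lemma sorted_prime_factorization (n : nat) : (0 < n)%N ->
  exists s : seq nat,
    [/\ sorted leq s, all prime s & n = (\prod_(q <- s) q)%N].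
Proof.
elim/ltn_ind: n => n IHn n_gt0.
have [n_gt1|n_le1] := ltnP 1 n; last first.
  by exists [::]; split=> //; rewrite big_nil; lia.
have pr_p := pdiv_prime n_gt1.
have p_gt1 := prime_gt1 pr_p.
have [m nE] := dvdnP (pdiv_dvd n).
have m_gt0 : (0 < m)%N by case: m nE n_gt0 => [->|].
have [|s [s_sorted s_prime mE]] := IHn m _ m_gt0; first by nia.
exists (pdiv n :: s); split; rewrite /= ?pr_p //; last first.
  by rewrite big_cons -mE mulnC.
rewrite path_min_sorted //; apply/allP => q q_s.
apply: pdiv_min_dvd; first exact: prime_gt1 (allP s_prime q q_s).
by rewrite nE mE; apply/dvdn_mulr; rewrite (big_rem q) //= dvdn_mulr.
Qed.

(** Since parts respect divisibility, a prime [p] dividing [n] then divides the part of [n] made of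
    primes at least [p]. *)
Lemma partn_ge_id (p : nat) : prime p -> (p`_[pred q | (q < p)%N]^' = p)%N.
Proof.
by move=> pr_p; apply: part_pnat_id; rewrite pnatE // inE /= inE ltnn.
Qed.

(** * Density as absence of gaps *)

Section Dense.
Context {R : realType} {y : R}.

(** The first term above [t] works: its predecessor is at most [t], and their ratio is at most
    [y]. *)
Lemma dense_path_gap (s : seq nat) (a t n : nat) : (0 < a <= t)%N ->
  path ltn a s -> path [rel a b : nat | b%:R / a%:R <= y] a s ->
  n \in a :: s -> (t < n)%N ->
  exists d, [/\ d \in s, (t < d)%N & d%:R <= y * t%:R].
Proof.
elim: s a => [|b s IHs] a /andP[a_gt0 le_at] /=.
  by move=> _ _; rewrite inE => /eqP ->; rewrite ltnNge le_at.
move=> /andP[lt_ab s_sorted] /andP[ba_le s_dense] n_s lt_tn.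
have [lt_tb|le_bt] := ltnP t b; last first.
  have n_bs : n \in b :: s.
    by move: n_s; rewrite inE => /orP[/eqP nE|//]; lia.
  have b_bnd : (0 < b <= t)%N by lia.
  have [d [d_s lt_td d_le]] := IHs b b_bnd s_sorted s_dense n_bs lt_tn.
  by exists d; split; rewrite // inE d_s orbT.
exists b; split; rewrite ?mem_head //.
have a_pos : 0 < a%:R :> R by rewrite ltr0n.
move: ba_le; rewrite ler_pdivrMr // => ba_le.
have at_R : a%:R <= t%:R :> R by rewrite ler_nat.
have y_ge0 : 0 <= y.
  by rewrite -(pmulr_lge0 _ a_pos) (le_trans _ ba_le).
exact: le_trans ba_le (ler_wpM2l y_ge0 at_R).
Qed.

(** The successor of a term is the least member above it, hence at most the [d] that the hypothesis
    gives. *)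
Lemma gap_dense_path (s : seq nat) (a n : nat) : (0 < a)%N ->
  path ltn a s -> all (geq n) s ->
  (forall t, t \in a :: s -> (t < n)%N ->
     exists d, [/\ d \in a :: s, (t < d)%N & d%:R <= y * t%:R]) ->
  path [rel a b : nat | b%:R / a%:R <= y] a s.
Proof.
elim: s a => //= b s IHs a a_gt0 /andP[lt_ab s_sorted] /andP[/= le_bn le_sn] gap.
have min_b d : d \in b :: s -> (b <= d)%N.
  rewrite inE => /orP[/eqP -> //|d_s].
  exact: ltnW (allP (order_path_min ltn_trans s_sorted) d d_s).
apply/andP; split.
  have [|d [d_s lt_ad d_le]] := gap a (mem_head _ _); first by lia.
  rewrite ler_pdivrMr ?ltr0n //; apply: le_trans d_le; rewrite ler_nat.
  by apply: min_b; move: d_s; rewrite inE => /orP[/eqP dE|//]; move: lt_ad; rewrite dE ltnn.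
apply: IHs => //; first by lia.
move=> t t_s lt_tn; have [|d [d_s lt_td d_le]] := gap t _ lt_tn.
  by rewrite inE t_s orbT.
exists d; split=> //; have := min_b t t_s.
by move: d_s; rewrite inE => /orP[/eqP dE|//]; lia.
Qed.

(* Gaps are tested at every integer [t], not only at elements of the sequence,
   so that the right-hand side is monotone in [P]. *)
Lemma dense_divisorsP (P : pred nat) (n : nat) :
  let s := [seq d <- divisors n | P d] in
  [/\ y_dense y s, 1%N \in s & n \in s] <->
  [/\ (0 < n)%N, P 1%N, P n &
      forall t, (0 < t < n)%N ->
        exists d, [/\ (d %| n)%N, P d, (t < d)%N & d%:R <= y * t%:R]].
Proof.
move=> s.
have sE d : (0 < n)%N -> (d \in s) = P d && (d %| n)%N.
  by move=> n_gt0; rewrite mem_filter dvdn_divisors.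
have s_sorted : sorted ltn s.
  exact: (sorted_filter ltn_trans _ (sorted_divisors_ltn n)).
split=> [[/andP[_ s_dense] s1 sn]|[n_gt0 P1 Pn gap]].
  have n_gt0 : (0 < n)%N.
    by rewrite lt0n; apply/eqP => n0; move: sn; rewrite mem_filter n0 => /andP[].
  move: (s1) (sn); rewrite !sE // => /andP[P1 _] /andP[Pn _].
  split=> // t /andP[t_gt0 lt_tn].
  have s_gt0 d : d \in s -> (0 < d)%N.
    by rewrite sE // => /andP[_ /dvdn_gt0]; apply.
  case sD: s => [|a s']; first by rewrite sD in s1.
  rewrite sD /= in s_sorted s_dense s1 sn s_gt0.
  have a_bnd : (0 < a <= t)%N.
    rewrite s_gt0 ?mem_head //=; apply: leq_trans t_gt0.
    move: s1; rewrite inE => /orP[/eqP <- //|s1].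
    exact: ltnW (allP (order_path_min ltn_trans s_sorted) _ s1).
  have [d [d_s lt_td d_le]] :=
    dense_path_gap _ _ _ _ a_bnd s_sorted s_dense sn lt_tn.
  have : d \in s by rewrite sD inE d_s orbT.
  by rewrite sE // => /andP[Pd dvd_d]; exists d.
have s1 : 1%N \in s by rewrite sE // P1 dvd1n.
split=> //; last by rewrite sE // Pn dvdnn.
rewrite /y_dense s_sorted /=.
have s_bnd d : d \in s -> (0 < d <= n)%N.
  by rewrite sE // => /andP[_ d_n]; rewrite (dvdn_gt0 n_gt0 d_n) dvdn_leq.
have s_gap t : t \in s -> (t < n)%N ->
    exists d, [/\ d \in s, (t < d)%N & d%:R <= y * t%:R].
  move=> /s_bnd/andP[t_gt0 _] lt_tn.
  have [|d [dvd_d Pd lt_td d_le]] := gap t; first by rewrite t_gt0.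
  by exists d; rewrite sE // Pd dvd_d.
case sD: s => [//|a s']; rewrite sD in s_sorted s_bnd s_gap.
apply: (gap_dense_path _ _ n) => //.
  by have /andP[] := s_bnd a (mem_head _ _).
by apply/allP => d d_s /=; have /andP[] := s_bnd d (mem_behead (s := a :: s') d_s).
Qed.

(** * [Dstar] inside [D_], and [D_] inside [B_] *)

Lemma D_gt0 (i n : nat) : D_ y i n -> (0 < n)%N.
Proof. by case: i => [//|i] /dense_divisorsP[]. Qed.

(** Dropping the condition on the cofactor only adds divisors, and the gap form of density survives
    this. *)
Lemma Dstar_sub_D (i : nat) : Dstar y i `<=` D_ y i.
Proof.
elim: i => [//|i IHi] n /Dstar_S/(_ i (leqnn i))/dense_divisorsP.
have sub d : d \in Dstar y i -> d \in D_ y i.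
  by rewrite !inE; apply: IHi.
case=> n_gt0 /andP[P1 _] /andP[Pn _] gap.
apply/dense_divisorsP; split=> //; [exact: sub | exact: sub |].
move=> t /gap[d [dvd_d /andP[Pd _] lt_td d_le]].
by exists d; split=> //; apply: sub.
Qed.

(* If [d] is a divisor of [n] in [D_ y i] just above the [p]-smooth part [m] of
   [n], then [d] has a prime factor [q >= p], and
   [q ^ i.+1 <= y ^ i * q * d`_(< q) <= y ^ i * d <= y ^ i.+1 * m]. *)
Lemma D_prime_le (i n p : nat) : 0 <= y -> D_ y i n -> prime p -> (p %| n)%N ->
  p%:R ^+ i <= y ^+ i * (n`_[pred q | (q < p)%N])%:R.
Proof.
move=> y_ge0; elim: i n p => [|i IHi] n p Dn pr_p dvd_pn.
  by rewrite !expr0 mul1r ler1n part_gt0.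
have n_gt0 := D_gt0 _ _ Dn.
move: Dn => /dense_divisorsP[_ _ _ gap].
set pi := [pred q | _]; set m := (n`_pi)%N.
have m_gt0 : (0 < m)%N by rewrite part_gt0.
have p_co : (p %| n`_pi^')%N.
  by rewrite -[X in (X %| _)%N](partn_ge_id _ pr_p); apply: partn_dvd.
have lt_mn : (m < n)%N.
  have nE := partnC pi n_gt0; rewrite -/m in nE.
  have := dvdn_leq (part_gt0 _ _) p_co; have := prime_gt1 pr_p; nia.
have [|d [dvd_dn Dd lt_md d_le]] := gap m; first by rewrite m_gt0.
rewrite inE in Dd.
have d_gt0 := dvdn_gt0 n_gt0 dvd_dn.
(* Otherwise all primes of [d] lie below [p], so [d] divides [m], against [m < d]. *)
have [q [pr_q dvd_qd le_pq]] : exists q, [/\ prime q, (q %| d)%N & (p <= q)%N].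
  apply: contrapT => noq.
  suff : (d %| m)%N by move/(dvdn_leq m_gt0); lia.
  have <- : (d`_pi = d)%N.
    apply: part_pnat_id; apply/pnatP => // q pr_q dvd_qd; rewrite inE /=.
    by rewrite ltnNge; apply/negP => le_pq; apply: noq; exists q.
  exact: partn_dvd.
have le_qd : (q * d`_[pred r | (r < q)%N] <= d)%N.
  rewrite -[leqRHS](partnC [pred r | (r < q)%N] d_gt0) mulnC leq_mul2l.
  apply/orP; right; apply: dvdn_leq; first exact: part_gt0.
  by rewrite -[X in (X %| _)%N](partn_ge_id _ pr_q); apply: partn_dvd.
have le_pq_R : p%:R ^+ i.+1 <= q%:R ^+ i.+1 :> R.
  by rewrite lerXn2r ?nnegrE ?ler_nat.
apply: (le_trans le_pq_R).
have := IHi d q Dd pr_q dvd_qd => IH.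
rewrite exprS (le_trans (ler_wpM2l (ler0n _ q) IH)) //.
rewrite mulrCA -natrM exprSr -mulrA ler_wpM2l ?exprn_ge0 //.
by apply: le_trans d_le; rewrite ler_nat.
Qed.

End Dense.

Lemma powR_invnK (R : realType) (i : nat) (z : R) : (0 < i)%N -> 0 <= z ->
  (z `^ i%:R^-1) ^+ i = z.
Proof.
move=> i_gt0 z_ge0; rewrite -powR_mulrn ?powR_ge0 // -powRrM mulVf ?powRr1 //.
by rewrite pnatr_eq0 -lt0n.
Qed.

Lemma D_sub_B (R : realType) (i : nat) (y : R) : (0 < i)%N -> 0 <= y ->
  D_ y i `<=` B_ (theta_u y i).
Proof.
move=> i_gt0 y_ge0 n Dn; have n_gt0 := D_gt0 _ _ Dn.
have [s [s_sorted s_prime nE]] := sorted_prime_factorization _ n_gt0.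
exists s; split=> // j lt_js.
have sP q : q \in s -> prime q by move/(allP s_prime).
set p := nth _ _ _; have p_s : p \in s by rewrite mem_nth.
have dvd_pn : (p %| n)%N by rewrite nE (big_rem p) //= dvdn_mulr.
rewrite -(@ler_pXn2r _ i) ?nnegrE // ?mulr_ge0 ?powR_ge0 //.
rewrite exprMn powR_invnK //.
apply: le_trans (D_prime_le _ _ _ y_ge0 Dn (sP _ p_s) dvd_pn) _.
rewrite ler_wpM2l ?exprn_ge0 // ler_nat.
have prod_gt0 (r : seq nat) : {subset r <= s} -> (0 < \prod_(q <- r) q)%N.
  by move=> sub; rewrite big_seq prodn_cond_gt0 // => q /sub/sP/prime_gt0.
have take_gt0 := prod_gt0 _ (@mem_take j _ s).
have drop_gt0 := prod_gt0 _ (@mem_drop j _ s).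
rewrite nE -{1}(cat_take_drop j s) big_cat partnM //=.
(* By sortedness no factor from index [j] on is below [p]. Copies of [p] may precede index [j], so
   the part below [p] need only divide the product of the first [j] factors. *)
have -> : ((\prod_(q <- drop j s) q)`_[pred q | (q < p)] = 1)%N.
  apply: part_p'nat; apply/pnatP => // q pr_q; rewrite !inE -leqNgt.
  rewrite Euclid_dvd_prod // big_has => /hasP[r r_s dvd_qr].
  have /eqP -> : q == r by rewrite -dvdn_prime2 // sP // (mem_drop r_s).
  move: r_s; rewrite (drop_nth 0%N) // -/p inE => /orP[/eqP ->//|r_s].
  have := drop_sorted j s_sorted; rewrite (drop_nth 0%N) //= -/p.
  by move/(order_path_min leq_trans)/allP/(_ _ r_s).
by rewrite muln1; apply/dvdn_leq/dvdn_part.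
Qed.

(** * Chains of primes and their splittings *)

Section Lower.
Context {R : realType} (y : R).

(* [lchain a n q] says that [n] lies in [B_ (theta_l y a)] with all prime
   factors at most [q]; exponentiating by [a] makes it meaningful for [a = 0],
   where it always holds. *)
Inductive lchain (a : nat) : nat -> nat -> Prop :=
| lchain1 q : lchain a 1 q
| lchainM n p q : lchain a n p -> prime p -> (p <= q)%N ->
    p%:R <= y \/ p%:R ^+ a <= y * n%:R -> lchain a (n * p) q.

Lemma lchain_widen (a n q r : nat) : (q <= r)%N -> lchain a n q -> lchain a n r.
Proof.
move=> le_qr ch; case: ch le_qr => {n q} [q|n p q ch pr_p le_pq p_le] le_qr.
  exact: lchain1.
by apply: lchainM ch pr_p _ p_le; apply: leq_trans le_qr.
Qed.

Lemma lchain_gt0 (a n q : nat) : lchain a n q -> (0 < n)%N.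
Proof. by elim=> // m p r _ m_gt0 /prime_gt0 p_gt0 _ _; rewrite muln_gt0 m_gt0. Qed.

Lemma lchain_anti (a b n q : nat) : (b <= a)%N -> lchain a n q -> lchain b n q.
Proof.
move=> le_ba; elim=> {n q} [q|n p q _ ch pr_p le_pq p_le]; first exact: lchain1.
apply: (lchainM _ _ p) => //; case: p_le => [|p_le]; [by left | right].
apply: le_trans p_le; apply: ler_weXn2l le_ba.
by rewrite ler1n prime_gt0.
Qed.

Lemma B_lchain (i n : nat) : (0 < i)%N -> 0 <= y ->
  B_ (theta_l y i) n -> exists q, lchain i n q.
Proof.
move=> i_gt0 y_ge0 [s [s_sorted s_prime -> s_le]].
(* The bound [r] stays free so that the induction hypothesis applies with the last prime as
   bound. *)
suff: forall r, all (geq r) s -> lchain i (\prod_(q <- s) q) r.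
  move=> ch; exists (\max_(q <- s) q)%N; apply: ch; apply/allP => q q_s /=.
  exact: leq_bigmax_seq.
elim/last_ind: s s_sorted s_prime s_le => [|s p IHs] s_sorted s_prime s_le r.
  by rewrite big_nil => _; apply: lchain1.
rewrite all_rcons big_rcons /= => /andP[le_pr _].
move: s_prime; rewrite all_rcons => /andP[pr_p s_prime].
move: s_sorted; rewrite (sorted_pairwise leq_trans) pairwise_rcons.
rewrite -(sorted_pairwise leq_trans) => /andP[s_le_p s_sorted].
apply: (lchainM _ _ p) => //.
  apply: IHs => // j lt_js; have := s_le j.
  rewrite size_rcons nth_rcons lt_js -cats1 (takel_cat _ (ltnW lt_js)).
  by move/(_ (leqW lt_js)).
have := s_le (size s); rewrite size_rcons nth_rcons ltnn eqxx -cats1.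
rewrite (takel_cat _ (leqnn _)) take_size => /(_ (ltnSn _)); rewrite /theta_l le_max.
case/orP=> [|p_le]; [by left | right].
rewrite -(powR_invnK _ _ _ i_gt0 (mulr_ge0 y_ge0 (ler0n _ _))).
by rewrite lerXn2r ?nnegrE ?powR_ge0.
Qed.

(* Build [d] and [e] one prime at a time, in increasing order. The next prime
   [p] goes to [e] when the cofactor is large enough to accept it, and otherwise
   to [d], with the target interval for the old [d] scaled down by [p]; the
   hypothesis [p ^ (a + b + 1) <= y n] makes one of the two possible. *)
Lemma lchain_split (a b n q : nat) (t : R) : 1 <= y ->
  lchain (a + b).+1 n q -> t < n%:R -> 1 <= y * t ->
  exists d e, [/\ n = (d * e)%N, lchain a d q, lchain b e q, t < d%:R
    & d%:R <= y * t].
Proof.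
move=> y_ge1 ch; elim: ch t => {n q} [q|n p q ch IH pr_p le_pq p_le] t lt_tn yt_ge1.
  by exists 1%N, 1%N; split=> //; apply: lchain1.
have y_gt0 : 0 < y by lra.
have t_gt0 : 0 < t by rewrite -(pmulr_rgt0 _ y_gt0); lra.
have p_gt0 : 0 < p%:R :> R by rewrite ltr0n prime_gt0.
have n_ge1 : 1 <= n%:R :> R by rewrite ler1n (lchain_gt0 _ _ _ ch).
have put_e : t < n%:R ->
    p%:R <= y \/ t * p%:R ^+ b <= n%:R ->
    exists d e, [/\ (n * p)%N = (d * e)%N, lchain a d q, lchain b e q,
      t < d%:R & d%:R <= y * t].
  move=> {}lt_tn p_small; have [d [e [nE chd che lt_td d_le]]] := IH t lt_tn yt_ge1.
  exists d, (e * p)%N; split; rewrite ?nE ?mulnA //; first exact: lchain_widen chd.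
  apply: lchainM che pr_p le_pq _; case: p_small => [|tp_le]; [by left | right].
  (* Cancel [t] in [t * p ^ b <= n = d * e <= y * t * e]. *)
  rewrite -(ler_pM2l t_gt0) (le_trans tp_le) // nE natrM mulrA (mulrC t).
  by rewrite ler_wpM2r // ltW.
(* The bound [p <= y * t] makes [t / p] an admissible target; the new [d] exceeds it, so
   [p ^ a <= y * d]. *)
have put_d : t < n%:R * p%:R -> p%:R <= y * t ->
    p%:R <= y \/ p%:R ^+ a <= y * (t / p%:R) ->
    exists d e, [/\ (n * p)%N = (d * e)%N, lchain a d q, lchain b e q,
      t < d%:R & d%:R <= y * t].
  move=> {}lt_tn p_le_yt p_small.
  have [||d [e [nE chd che lt_td d_le]]] := IH (t / p%:R).
  - by rewrite ltr_pdivrMr.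
  - by rewrite mulrA ler_pdivlMr ?mul1r.
  exists (d * p)%N, e; split.
  - by rewrite nE mulnAC.
  - apply: lchainM chd pr_p le_pq _; case: p_small => [|pa_le]; [by left | right].
    by apply: le_trans pa_le _; rewrite ler_wpM2l ?ltW.
  - exact: lchain_widen che.
  - by rewrite natrM -ltr_pdivrMr.
  - by rewrite natrM -ler_pdivlMr // -mulrA.
rewrite natrM in lt_tn.
(* A prime at most [y] fits either factor, so only the size of [t] against [n] decides. *)
have [p_le_y|lt_yp] := leP p%:R y.
  have [lt_tn'|le_nt] := ltP t n%:R; first by apply: put_e => //; left.
  by apply: put_d => //; [nra | left].
have {p_le} p_le : p%:R ^+ (a + b).+1 <= y * n%:R.
  by case: p_le => // p_le; move: lt_yp; rewrite ltNge p_le.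
have pb_ge1 : 1 <= p%:R ^+ b :> R by rewrite exprn_ege1 // ler1n prime_gt0.
have pa_ge1 : 1 <= p%:R ^+ a :> R by rewrite exprn_ege1 // ler1n prime_gt0.
have [lt_tpn|le_ntp] := ltP (t * p%:R ^+ b) n%:R.
  by apply: put_e; [nra | right; apply: ltW].
(* Cancel [p ^ b] in [p ^ (a + b + 1) <= y * n <= y * t * p ^ b]; the result gives both conditions
   of [put_d]. *)
have pa_le : p%:R ^+ a.+1 <= y * t.
  rewrite -(ler_pM2r (lt_le_trans ltr01 pb_ge1)) -exprD addSn.
  by apply: (le_trans p_le); rewrite -mulrA ler_wpM2l // ltW.
apply: put_d => //.
  by apply: le_trans pa_le; rewrite exprS ler_peMr // ltW.
by right; rewrite mulrA ler_pdivlMr // -exprSr.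
Qed.

(** Strong induction on the index: splitting with [a = j] and [b = i - j] fills each gap, and both
    indices are below [i.+1]. *)
Lemma lchain_Dstar (i n q : nat) : 1 <= y -> lchain i n q -> Dstar y i n.
Proof.
move=> y_ge1; elim/ltn_ind: i n q => -[_ n q /lchain_gt0 //|i IHi] n q ch.
apply/Dstar_S => j le_ji; apply/dense_divisorsP.
have IH k m r : (k <= i)%N -> lchain k m r -> m \in Dstar y k.
  by move=> le_ki chm; rewrite inE; apply: IHi chm.
have chW k : (k <= i)%N -> lchain k n q.
  by move=> le_ki; apply: lchain_anti ch; apply: leqW.
have n_gt0 := lchain_gt0 _ _ _ ch.
split=> //.
- rewrite divn1 (IH _ _ q le_ji (lchain1 _ _)) /=.
  by apply: (IH _ _ q); rewrite ?leq_subr //; apply/chW/leq_subr.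
- rewrite divnn n_gt0 (IH _ _ q le_ji (chW _ le_ji)) /=.
  by apply: (IH _ _ q); rewrite ?leq_subr //; apply: lchain1.
move=> t /andP[t_gt0 lt_tn].
have [||||d [e [nE chd che lt_td d_le]]] := lchain_split j (i - j) n q t%:R.
- exact: y_ge1.
- by rewrite subnKC.
- by rewrite ltr_nat.
- by rewrite mulr_ege1 // ler1n.
have d_gt0 := lchain_gt0 _ _ _ chd.
exists d; split=> //; last by rewrite -(ltr_nat R).
  by rewrite nE dvdn_mulr.
by rewrite nE mulKn // (IH _ _ q le_ji chd) (IH _ _ q _ che) // leq_subr.
Qed.

End Lower.

Theorem theorem2 (R : realType) (i : nat) (y : R)
    (i_gt0 : (0 < i)%N) (y_ge2 : 2 <= y) :
  [/\ smooth y `<=` B_ (theta_l y i),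
      B_ (theta_l y i) `<=` Dstar y i,
      Dstar y i `<=` D_ y i &
      D_ y i `<=` B_ (theta_u y i)].
Proof.
have y_ge0 : 0 <= y by lra.
split.
- move=> n [n_gt0 n_smooth].
  have [s [s_sorted s_prime nE]] := sorted_prime_factorization _ n_gt0.
  exists s; split=> // j lt_js; rewrite le_max n_smooth //.
    by apply: (allP s_prime); apply: mem_nth.
  by rewrite nE (big_rem (nth 0%N s j)) ?mem_nth //= dvdn_mulr.
- move=> n /B_lchain[] // q; apply: lchain_Dstar; lra.
- exact: Dstar_sub_D.
- exact: D_sub_B.
Qed.
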